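(* The algorithm SQEMA succeeds on every conjunction of monadic inductive formulae.
   Context: Basic modal language $\mathrm{ML}$: $\top,\bot$, propositional variables, $\neg,\wedge,\vee,\rightarrow,\Diamond,\Box$. A formula is positive if every occurrence of a propositional variable is in the scope of an even number of negations. Box-forms of a symbol $\sharp$: $\sharp$ is one; if $\mathbf{B}(\sharp)$ is one then so are $\Box\mathbf{B}(\sharp)$ and $A\rightarrow\mathbf{B}(\sharp)$ for any positive formula $A$. Substituting a propositional variable $p$ for $\sharp$ gives a box-formula $\mathbf{B}(p)$ of $p$; that (last) occurrence of $p$ is its head, all other variable occurrences in it are inessential. A monadic regular formula is built from $\top$, $\bot$, positive formulae and negated box-formulae using $\wedge$, $\vee$, $\Box$. The dependency digraph of a set of box-formulae has as vertices their heads, with an edge $p_i\to p_j$ iff $p_i$ occurs as an inessential variable in a box-formula of the set with head $p_j$; the dependency digraph of a formula is that of the set of box-formulae occurring as its subformulae. A monadic inductive formula is a monadic regular formula whose dependency digraph is acyclic (no oriented cycles, including loops). $\mathrm{ML}^+$ adds nominals (denoting singletons; disregarded for polarity) and $\Diamond^{-1},\Box^{-1}$. SQEMA rewriting rules on systems (finite sets) of equations $\alpha\rightarrow\beta$ in $\mathrm{ML}^+$: $\wedge$-rule ($\beta\rightarrow\gamma\wedge\delta$ becomes $\beta\rightarrow\gamma$, $\beta\rightarrow\delta$); left-shift $\vee$-rule ($\beta\rightarrow\gamma\vee\delta$ becomes $(\beta\wedge\neg\gamma)\rightarrow\delta$) and its converse; left-shift $\Box$-rule ($\gamma\rightarrow\Box\delta$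 becomes $\Diamond^{-1}\gamma\rightarrow\delta$) and its converse; $\Diamond$-rule ($\mathbf{j}\rightarrow\Diamond\gamma$, $\mathbf{j}$ a nominal, becomes $\mathbf{j}\rightarrow\Diamond\mathbf{k}$, $\mathbf{k}\rightarrow\gamma$, $\mathbf{k}$ a new nominal); Ackermann-rule (if the equations containing $p$ are exactly $\alpha_1\rightarrow p,\ldots,\alpha_n\rightarrow p$ with $p$ not in the $\alpha$'s, and $\beta_1,\ldots,\beta_m$ each negative in $p$, replace them by $\beta_j[(\alpha_1\vee\cdots\vee\alpha_n)/p]$); polarity switching (replace $p$ by $\neg p$ and $\neg p$ by $p$ throughout); auxiliary propositional simplification rules ($\gamma\vee\neg\gamma\mapsto\top$, $\gamma\wedge\bot\mapsto\bot$, etc., and $\neg\Diamond\neg\mapsto\Box$, $\neg\Box\neg\mapsto\Diamond$). On input $\phi\in\mathrm{ML}$: (1) put $\neg\phi$ in negation normal form and distribute $\Diamond$ and $\wedge$ over $\vee$ as much as possible, giving $\bigvee_k\alpha_k$; (2) for each $k$ start from the system $\{\mathbf{i}\rightarrow\alpha_k\}$, $\mathbf{i}$ a reserved nominal; (3) replace every variable in which the system is positive (negative) by $\top$ ($\bot$); (4–5) repeatedly choose a remaining variable and apply the rules (possibly polarity switching) so as to enable and apply the Ackermann-rule to eliminate it, backtracking over choices. SQEMA succeeds on $\phi$ if for every disjunct $\alpha_k$ some sequence of such steps yields a system containing no propositional variables. *)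

(* Defs.v *)
From mathcomp Require Import all_boot.
From Stdlib Require Import Relations.Relation_Operators.
From Stdlib Require List.

Set Implicit Arguments.
Unset Strict Implicit.
Unset Printing Implicit Defensive.

(** * The languages ML and ML+ *)

(* Formulae of ML+; propositional variables and nominals are both named by
   natural numbers.  DiaInv and BoxInv are the inverse modalities. *)
Inductive form : Type :=
  | Top
  | Bot
  | Var of nat
  | Nom of nat
  | Neg of form
  | And of form & form
  | Or of form & form
  | Imp of form & form
  | Dia of form
  | Box of form
  | DiaInv of form
  | BoxInv of form.

Fixpoint is_ML (a : form) : bool :=
  match a with
  | Top | Bot | Var _ => true
  | Neg b | Dia b | Box b => is_ML b
  | And b c | Or b c | Imp b c => is_ML b && is_ML c
  | Nom _ | DiaInv _ | BoxInv _ => false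
  end.

Fixpoint vars (a : form) : seq nat :=
  match a with
  | Top | Bot | Nom _ => [::]
  | Var p => [:: p]
  | Neg b | Dia b | Box b | DiaInv b | BoxInv b => vars b
  | And b c | Or b c | Imp b c => vars b ++ vars c
  end.

Fixpoint noms (a : form) : seq nat :=
  match a with
  | Top | Bot | Var _ => [::]
  | Nom i => [:: i]
  | Neg b | Dia b | Box b | DiaInv b | BoxInv b => noms b
  | And b c | Or b c | Imp b c => noms b ++ noms c
  end.

(* [pol_in true p a] (resp. [pol_in false p a]): every occurrence of p in a is
   in the scope of an even (resp. odd) number of negations, the antecedent of
   an implication counting as negated. *)
Fixpoint pol_in (s : bool) (p : nat) (a : form) : bool :=
  match a with
  | Top | Bot | Nom _ => true
  | Var q => (q == p) ==> s
  | Neg b => pol_in (~~ s) p b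
  | And b c | Or b c => pol_in s p b && pol_in s p c
  | Imp b c => pol_in (~~ s) p b && pol_in s p c
  | Dia b | Box b | DiaInv b | BoxInv b => pol_in s p b
  end.

Definition positive_in := pol_in true.
Definition negative_in := pol_in false.

Definition positive (a : form) : bool := all (fun p => positive_in p a) (vars a).

Fixpoint subst (s : nat -> form) (a : form) : form :=
  match a with
  | Top => Top
  | Bot => Bot
  | Var p => s p
  | Nom i => Nom i
  | Neg b => Neg (subst s b)
  | And b c => And (subst s b) (subst s c)
  | Or b c => Or (subst s b) (subst s c)
  | Imp b c => Imp (subst s b) (subst s c)
  | Dia b => Dia (subst s b)
  | Box b => Box (subst s b)
  | DiaInv b => DiaInv (subst s b)
  | BoxInv b => BoxInv (subst s b)
  end.

Definition subst1 (p : nat) (a : form) : form -> form :=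
  subst (fun q => if q == p then a else Var q).

Fixpoint subformula (b a : form) : Prop :=
  b = a \/
  match a with
  | Top | Bot | Var _ | Nom _ => False
  | Neg c | Dia c | Box c | DiaInv c | BoxInv c => subformula b c
  | And c d | Or c d | Imp c d => subformula b c \/ subformula b d
  end.

(** * Monadic inductive formulae *)

Inductive preform : Type :=
  | Sharp
  | BBox of preform
  | BImp of form & preform.

Fixpoint box_form (B : preform) : bool :=
  match B with
  | Sharp => true
  | BBox B' => box_form B'
  | BImp a B' => [&& is_ML a, positive a & box_form B']
  end.

(* The result B(p) of substituting p for the sharp. *)
Fixpoint fill (B : preform) (p : nat) : form :=
  match B with
  | Sharp => Var p
  | BBox B' => Box (fill B' p)
  | BImp a B' => Imp a (fill B' p)
  end.

Fixpoint inessential (B : preform) : seq nat :=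
  match B with
  | Sharp => [::]
  | BBox B' => inessential B'
  | BImp a B' => vars a ++ inessential B'
  end.

Definition box_formula (a : form) : Prop :=
  exists B p, box_form B /\ a = fill B p.

Inductive monadic_regular : form -> Prop :=
  | reg_top : monadic_regular Top
  | reg_bot : monadic_regular Bot
  | reg_pos a : is_ML a -> positive a -> monadic_regular a
  | reg_nbox B p : box_form B -> monadic_regular (Neg (fill B p))
  | reg_and a b :
      monadic_regular a -> monadic_regular b -> monadic_regular (And a b)
  | reg_or a b :
      monadic_regular a -> monadic_regular b -> monadic_regular (Or a b)
  | reg_box a : monadic_regular a -> monadic_regular (Box a).

(* Dependency digraph of a set S of box-formulae. *)
Definition dep_vertex (S : form -> Prop) (p : nat) : Prop :=
  exists B, box_form B /\ S (fill B p).

Definition dep_edge (S : form -> Prop) (p q : nat) : Prop :=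
  [/\ dep_vertex S p, dep_vertex S q &
      exists B, [/\ box_form B, S (fill B q) & p \in inessential B]].

Definition acyclic (e : nat -> nat -> Prop) : Prop :=
  forall p, ~ clos_trans nat e p p.

Definition box_subformulae (a b : form) : Prop :=
  box_formula b /\ subformula b a.

Definition monadic_inductive (a : form) : Prop :=
  monadic_regular a /\ acyclic (dep_edge (box_subformulae a)).

(* Conjunctions of one or more P-formulae, with arbitrary bracketing. *)
Inductive conjunction_of (P : form -> Prop) : form -> Prop :=
  | conj_one a : P a -> conjunction_of P a
  | conj_and a b :
      conjunction_of P a -> conjunction_of P b -> conjunction_of P (And a b).

(** * The algorithm SQEMA *)

(* [nnf true a] and [nnf false a] are negation normal forms of a and of its
   negation. *)
Fixpoint nnf (s : bool) (a : form) : form :=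
  match a with
  | Top => if s then Top else Bot
  | Bot => if s then Bot else Top
  | Var p => if s then Var p else Neg (Var p)
  | Nom i => if s then Nom i else Neg (Nom i)
  | Neg b => nnf (~~ s) b
  | And b c => if s then And (nnf s b) (nnf s c) else Or (nnf s b) (nnf s c)
  | Or b c => if s then Or (nnf s b) (nnf s c) else And (nnf s b) (nnf s c)
  | Imp b c =>
      if s then Or (nnf false b) (nnf true c) else And (nnf true b) (nnf false c)
  | Dia b => if s then Dia (nnf s b) else Box (nnf s b)
  | Box b => if s then Box (nnf s b) else Dia (nnf s b)
  | DiaInv b => if s then DiaInv (nnf s b) else BoxInv (nnf s b)
  | BoxInv b => if s then BoxInv (nnf s b) else DiaInv (nnf s b)
  end.

Fixpoint bigor (l : seq form) : form :=
  match l with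
  | [::] => Bot
  | [:: a] => a
  | a :: l' => Or a (bigor l')
  end.

(* The disjuncts obtained from an ML-formula in negation normal form by
   distributing diamonds and conjunctions over disjunctions everywhere, also
   below boxes. *)
Fixpoint disjuncts (a : form) : seq form :=
  match a with
  | Or b c => disjuncts b ++ disjuncts c
  | And b c => [seq And x y | x <- disjuncts b, y <- disjuncts c]
  | Dia b => [seq Dia x | x <- disjuncts b]
  | Box b => [:: Box (bigor (disjuncts b))]
  | _ => [:: a]
  end.

(* A list of formulae stands for the finite set of its elements; the equation
   a -> b is the formula [Imp a b].  Members need not be implications only
   because the simplifications of [simp] may turn an equation into another
   formula. *)
Definition system := seq form.

(* The reserved nominal of the initial systems. *)
Definition nom_i : nat := 0.

Definition initial_system (a : form) : system := [:: Imp (Nom nom_i) a].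

Definition eliminate_pure (S : system) : system :=
  [seq subst (fun p => if all (positive_in p) S then Top
                       else if all (negative_in p) S then Bot
                       else Var p) e | e <- S].

(* The auxiliary rules, applied to one subformula occurrence. *)
Inductive simp : form -> form -> Prop :=
  | simp_andC a b : simp (And a b) (And b a)
  | simp_orC a b : simp (Or a b) (Or b a)
  | simp_andA a b c : simp (And a (And b c)) (And (And a b) c)
  | simp_andA' a b c : simp (And (And a b) c) (And a (And b c))
  | simp_orA a b c : simp (Or a (Or b c)) (Or (Or a b) c)
  | simp_orA' a b c : simp (Or (Or a b) c) (Or a (Or b c))
  | simp_or_neg a : simp (Or a (Neg a)) Top
  | simp_and_neg a : simp (And a (Neg a)) Bot
  | simp_or_top a : simp (Or a Top) Top
  | simp_or_bot a : simp (Or a Bot) a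
  | simp_and_top a : simp (And a Top) a
  | simp_and_bot a : simp (And a Bot) Bot
  | simp_imp_bot a : simp (Imp a Bot) (Neg a)
  | simp_imp_top a : simp (Imp a Top) Top
  | simp_bot_imp a : simp (Imp Bot a) Top
  | simp_top_imp a : simp (Imp Top a) a
  | simp_neg_neg a : simp (Neg (Neg a)) a
  | simp_neg_top : simp (Neg Top) Bot
  | simp_neg_bot : simp (Neg Bot) Top
  | simp_neg_dia a : simp (Neg (Dia (Neg a))) (Box a)
  | simp_neg_box a : simp (Neg (Box (Neg a))) (Dia a)
  | simp_neg a a' : simp a a' -> simp (Neg a) (Neg a')
  | simp_andl a a' b : simp a a' -> simp (And a b) (And a' b)
  | simp_andr a b b' : simp b b' -> simp (And a b) (And a b')
  | simp_orl a a' b : simp a a' -> simp (Or a b) (Or a' b)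
  | simp_orr a b b' : simp b b' -> simp (Or a b) (Or a b')
  | simp_impl a a' b : simp a a' -> simp (Imp a b) (Imp a' b)
  | simp_impr a b b' : simp b b' -> simp (Imp a b) (Imp a b')
  | simp_dia a a' : simp a a' -> simp (Dia a) (Dia a')
  | simp_box a a' : simp a a' -> simp (Box a) (Box a')
  | simp_diainv a a' : simp a a' -> simp (DiaInv a) (DiaInv a')
  | simp_boxinv a a' : simp a a' -> simp (BoxInv a) (BoxInv a').

(* Rules replacing one equation by finitely many, in a system whose nominals
   are all in N. *)
Inductive eq_rule (N : seq nat) : form -> seq form -> Prop :=
  | rule_and b c d : eq_rule N (Imp b (And c d)) [:: Imp b c; Imp b d]
  | rule_or_left b c d : eq_rule N (Imp b (Or c d)) [:: Imp (And b (Neg c)) d]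
  | rule_or_right b c d : eq_rule N (Imp (And b (Neg c)) d) [:: Imp b (Or c d)]
  | rule_box_left c d : eq_rule N (Imp c (Box d)) [:: Imp (DiaInv c) d]
  | rule_box_right c d : eq_rule N (Imp (DiaInv c) d) [:: Imp c (Box d)]
  | rule_dia j k c : k \notin N -> k != nom_i ->
      eq_rule N (Imp (Nom j) (Dia c)) [:: Imp (Nom j) (Dia (Nom k)); Imp (Nom k) c]
  | rule_simp e e' : simp e e' -> eq_rule N e [:: e'].

Fixpoint switch_polarity (p : nat) (a : form) : form :=
  match a with
  | Top => Top
  | Bot => Bot
  | Var q => if q == p then Neg (Var p) else Var q
  | Nom i => Nom i
  | Neg b =>
      match b with
      | Var q => if q == p then Var p else Neg (Var q)
      | _ => Neg (switch_polarity p b)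
      end
  | And b c => And (switch_polarity p b) (switch_polarity p c)
  | Or b c => Or (switch_polarity p b) (switch_polarity p c)
  | Imp b c => Imp (switch_polarity p b) (switch_polarity p c)
  | Dia b => Dia (switch_polarity p b)
  | Box b => Box (switch_polarity p b)
  | DiaInv b => DiaInv (switch_polarity p b)
  | BoxInv b => BoxInv (switch_polarity p b)
  end.

(* [Some a] if e is the equation a -> p with p not in a. *)
Definition solved_for (p : nat) (e : form) : option form :=
  match e with
  | Imp a (Var q) => if (q == p) && (p \notin vars a) then Some a else None
  | _ => None
  end.

(* The left-hand sides of the equations solved for p, and the other members. *)
Definition solutions (p : nat) (S : system) : seq form := pmap (solved_for p) S.
Definition unsolved (p : nat) (S : system) : system :=
  [seq e <- S | ~~ isSome (solved_for p e)].

Inductive sqema_step : system -> system -> Prop :=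
  | step_rule S e es S' :
      List.In e S -> eq_rule (flatten (map noms S)) e es ->
      (forall x, List.In x S' <-> (List.In x S /\ x <> e) \/ List.In x es) ->
      sqema_step S S'
  | step_switch p S : sqema_step S (map (switch_polarity p) S)
  | step_ackermann p S :
      0 < size (solutions p S) -> all (negative_in p) (unsolved p S) ->
      sqema_step S (map (subst1 p (bigor (solutions p S))) (unsolved p S)).

Definition sqema_succeeds (phi : form) : Prop :=
  forall a, List.In a (disjuncts (nnf true (Neg phi))) ->
    exists S, clos_refl_trans system sqema_step
                (eliminate_pure (initial_system a)) S
              /\ all (fun e => nilp (vars e)) S.

(* Main.v *)
From HB Require Import structures.
Require Import Defs.
From mathcomp Require Import all_boot.
From Stdlib Require Import Relations.Relation_Operators.
From Stdlib Require List.

(** The disjuncts of the negated formula are built with [And] and [Dia] from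
    formulae negative in every variable and from formulae [D] of the shape
    [D ::= Var p | Box D | Or n D], [n] negative, whose variables other than
    the head [p] precede [p] in the dependency digraph.  The rules turn the
    initial equation into equations that are negative in every variable or of
    the form [g -> p] with [g] positive and all its variables below [p].
    Acyclicity makes every [g -> p] solved for [p], the Ackermann rule applies
    to any [p] that has such an equation, and transitivity of the dependency
    order preserves the shape of the system.  Every remaining variable has
    such an equation, because variables without positive occurrences were
    removed at the start and no step creates new ones. *)

Set Implicit Arguments.
Unset Strict Implicit.
Unset Printing Implicit Defensive.

(** * Decidable equality of formulae *)

Lemma form_comparable : comparable form.
Proof. by rewrite /comparable /decidable; decide equality; apply: eq_comparable. Qed.

HB.instance Definition _ := hasDecEq.Build form (compareP form_comparable).

Lemma InP (T : eqType) (x : T) (s : seq T) : reflect (List.In x s) (x \in s).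
Proof.
elim: s => [|y s IHs] /=; first exact: ReflectF.
rewrite inE eq_sym; apply: (iffP orP) => -[].
- by move/eqP; left.
- by move/IHs; right.
- by move=> ->; left.
- by move/IHs; right.
Qed.

(** * Polarity *)

(** Both signs hold vacuously for an absent variable, and any occurrence violates one of them. So
    occurrence can be handled through polarity alone. *)
Lemma pol_in_vars p a : (p \in vars a) = ~~ (pol_in true p a && pol_in false p a).
Proof.
elim: a => //=.
- by move=> q; rewrite inE eq_sym; case: (q == p).
- by move=> a ->; rewrite andbC.
- by move=> a IHa b IHb; rewrite mem_cat IHa IHb; do 4 case: (pol_in _ _ _).
- by move=> a IHa b IHb; rewrite mem_cat IHa IHb; do 4 case: (pol_in _ _ _).
- by move=> a IHa b IHb; rewrite mem_cat IHa IHb; do 4 case: (pol_in _ _ _).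
Qed.

Lemma pol_in_notin s p a : p \notin vars a -> pol_in s p a.
Proof. by rewrite pol_in_vars negbK; case: s => /andP []. Qed.

Lemma positiveP a : positive a -> forall p, pol_in true p a.
Proof.
move=> /allP pos_a p; have [/pos_a //|] := boolP (p \in vars a).
exact: pol_in_notin.
Qed.

Lemma pol_in_nnf s t p a : pol_in s p (nnf t a) = pol_in (t == s) p a.
Proof.
elim: a s t => //=.
- by move=> s [].
- by move=> s [].
- by move=> q [] [].
- by move=> i s [].
- by move=> a IHa s t; rewrite IHa; case: s t => [] [].
- by move=> a IHa b IHb s [] /=; rewrite IHa IHb; case: s.
- by move=> a IHa b IHb s [] /=; rewrite IHa IHb; case: s.
- by move=> a IHa b IHb s [] /=; rewrite IHa IHb; case: s.
- by move=> a IHa s [] /=; rewrite IHa; case: s.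
- by move=> a IHa s [] /=; rewrite IHa; case: s.
- by move=> a IHa s [] /=; rewrite IHa; case: s.
- by move=> a IHa s [] /=; rewrite IHa; case: s.
Qed.

Lemma pol_in_bigor s p l : pol_in s p (bigor l) = all (pol_in s p) l.
Proof. by elim: l => //= a [|b l] /= IHl; rewrite ?andbT // IHl. Qed.

Lemma pol_in_disjuncts s p a x :
  pol_in s p a -> x \in disjuncts a -> pol_in s p x.
Proof.
elim: a x => /=.
- by move=> x _; rewrite inE => /eqP ->.
- by move=> x _; rewrite inE => /eqP ->.
- by move=> q x h; rewrite inE => /eqP ->.
- by move=> q x _; rewrite inE => /eqP ->.
- by move=> a _ x h; rewrite inE => /eqP ->.
- move=> a IHa b IHb x /andP [ha hb] /allpairsP [[y z] /= [hy hz ->]] /=.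
  by rewrite IHa // IHb.
- move=> a IHa b IHb x /andP [ha hb]; rewrite mem_cat => /orP [].
    exact: IHa.
  exact: IHb.
- by move=> a _ b _ x h; rewrite inE => /eqP ->.
- by move=> a IHa x h /mapP [y hy ->] /=; apply: IHa.
- move=> a IHa x h; rewrite inE => /eqP -> /=; rewrite pol_in_bigor.
  by apply/allP => y; apply: IHa.
- by move=> a _ x h; rewrite inE => /eqP ->.
- by move=> a _ x h; rewrite inE => /eqP ->.
Qed.

(* An occurrence of [r] of sign [t] in [a] puts [sigma r] under sign [t]. *)
Lemma pol_in_subst s q sigma a :
  (forall t r, pol_in (~~ t) r a || pol_in (t == s) q (sigma r)) ->
  pol_in s q (subst sigma a).
Proof.
elim: a s => //=.
- by move=> p s /(_ true p); rewrite eqxx /=; case: s.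
- move=> a IHa s h; apply: IHa => t r; move: (h (~~ t) r).
  by case: t s {h} => [] [].
- move=> a IHa b IHb s h; rewrite IHa ?IHb //.
    by move=> t r; move: (h t r); case: (pol_in _ _ a); case: (pol_in _ _ b).
  by move=> t r; move: (h t r); case: (pol_in _ _ a); case: (pol_in _ _ b).
- move=> a IHa b IHb s h; rewrite IHa ?IHb //.
    by move=> t r; move: (h t r); case: (pol_in _ _ a); case: (pol_in _ _ b).
  by move=> t r; move: (h t r); case: (pol_in _ _ a); case: (pol_in _ _ b).
- move=> a IHa b IHb s h; rewrite IHa ?IHb //.
    by move=> t r; move: (h t r); case: (pol_in _ _ a); case: (pol_in _ _ b).
  move=> t r; move: (h (~~ t) r).
  by case: t s {h} => [] []; do 2 case: (pol_in _ r _).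
Qed.

(** Each occurrence of [q] in [a] survives in place, with its sign. *)
Lemma pol_in_subst_fixed s q sigma a :
  sigma q = Var q -> pol_in s q (subst sigma a) -> pol_in s q a.
Proof.
move=> sq; elim: a s => //=.
- by move=> p s; case: (eqVneq p q) => [->|//]; rewrite sq /= eqxx.
- by move=> a IHa s /IHa.
- by move=> a IHa b IHb s /andP [/IHa -> /IHb ->].
- by move=> a IHa b IHb s /andP [/IHa -> /IHb ->].
- by move=> a IHa b IHb s /andP [/IHa -> /IHb ->].
Qed.

(** * The shapes of equations and disjuncts *)

Section Dependency.

Variable R : nat -> nat -> Prop.
Hypothesis R_trans : forall p q r, R p q -> R q r -> R p r.
Hypothesis R_irrefl : forall p, ~ R p p.

Definition negative_form a := forall p, pol_in false p a.

(** A box-formula of head [p] after normalisation, its antecedents having become negative disjuncts.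
    For negative [n], [~~ pol_in true q n] says that [q] occurs in [n]. *)
Inductive boxlike (p : nat) : form -> Prop :=
  | boxlike_var : boxlike p (Var p)
  | boxlike_box d : boxlike p d -> boxlike p (Box d)
  | boxlike_or n d : negative_form n -> (forall q, ~~ pol_in true q n -> R q p) ->
      boxlike p d -> boxlike p (Or n d).

Inductive inductive_disjunct : form -> Prop :=
  | disjunct_neg a : negative_form a -> inductive_disjunct a
  | disjunct_box p d : boxlike p d -> inductive_disjunct d
  | disjunct_and a b :
      inductive_disjunct a -> inductive_disjunct b -> inductive_disjunct (And a b)
  | disjunct_dia a : inductive_disjunct a -> inductive_disjunct (Dia a).

Definition positive_below p g :=
  (forall q, pol_in true q g) /\ (forall q, ~~ pol_in false q g -> R q p).

Inductive shaped : form -> Prop :=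
  | shaped_neg e : negative_form e -> shaped e
  | shaped_pos g p : positive_below p g -> shaped (Imp g (Var p)).

Lemma boxlike_bigor p l d :
  (forall n, n \in l -> negative_form n /\ (forall q, ~~ pol_in true q n -> R q p)) ->
  boxlike p d -> boxlike p (bigor (rcons l d)).
Proof.
elim: l => //= n l IHl hl bd.
have [neg_n below_n] := hl n (mem_head _ _).
have bl : boxlike p (bigor (rcons l d)).
  by apply: IHl => // m m_l; apply: hl; rewrite inE m_l orbT.
(* [bigor] unfolds to an [Or] only once its tail is known to be nonempty. *)
case: (rcons l d) (size_rcons l d) bl => // a l' _ bl.
exact: boxlike_or.
Qed.

(** Implications outside all boxes split: their antecedents yield negative disjuncts and the head
    stays in the last one. Below a box the pieces are joined again by [bigor]. *)
Lemma disjuncts_fill B p :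
  box_form B -> (forall q, q \in inessential B -> R q p) ->
  exists l d, [/\ disjuncts (nnf true (fill B p)) = rcons l d, boxlike p d &
    forall n, n \in l -> negative_form n /\ (forall q, ~~ pol_in true q n -> R q p)].
Proof.
elim: B => [|B IHB|a B IHB] /=.
- by exists [::], (Var p); split=> //; apply: boxlike_var.
- move=> box_B below; have [l [d [-> bd hl]]] := IHB box_B below.
  exists [::], (Box (bigor (rcons l d))); split=> //.
  by apply: boxlike_box; apply: boxlike_bigor.
- move=> /and3P [_ /positiveP pos_a box_B] below.
  have [|l [d [-> bd hl]]] := IHB box_B.
    by move=> q hq; apply: below; rewrite mem_cat hq orbT.
  exists (disjuncts (nnf false a) ++ l), d; split=> //; first by rewrite rcons_cat.
  move=> n; rewrite mem_cat => /orP [n_a|/hl //]; split=> q.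
    by apply: pol_in_disjuncts n_a; rewrite pol_in_nnf pos_a.
  move=> hq; apply: below; rewrite mem_cat pol_in_vars; apply/orP; left.
  apply: contra hq => /andP [_ hq]; apply: pol_in_disjuncts n_a.
  by rewrite pol_in_nnf.
Qed.

(** Under negation a conjunction concatenates the lists of disjuncts, a disjunction pairs them by
    [And], and a box maps [Dia] over them. *)
Lemma disjuncts_regular a :
  monadic_regular a ->
  (forall B p q, box_form B -> subformula (fill B p) a -> q \in inessential B -> R q p) ->
  forall x, x \in disjuncts (nnf false a) -> inductive_disjunct x.
Proof.
elim=> {a} [|||B p box_B|a b _ IHa _ IHb|a b _ IHa _ IHb|a _ IHa] /=.
- by move=> _ x; rewrite inE => /eqP ->; apply: disjunct_neg.
- by move=> _ x; rewrite inE => /eqP ->; apply: disjunct_neg.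
- move=> a _ /positiveP pos_a _ x x_a; apply: disjunct_neg => p.
  by apply: pol_in_disjuncts x_a; rewrite pol_in_nnf pos_a.
- move=> below x; have [|l [d [-> bd hl]]] := disjuncts_fill (p := p) box_B.
    by move=> q; apply: below => //; right; case: (B) => *; left.
  rewrite mem_rcons inE => /predU1P [->|/hl [neg_x _]]; last exact: disjunct_neg.
  exact: disjunct_box bd.
- move=> below x; rewrite mem_cat => /orP [].
    by apply: IHa => B p q hB hs; apply: below => //; right; left.
  by apply: IHb => B p q hB hs; apply: below => //; right; right.
- move=> below x /allpairsP [[y z] /= [hy hz ->]]; apply: disjunct_and.
    by apply: IHa hy => B p q hB hs; apply: below => //; right; left.
  by apply: IHb hz => B p q hB hs; apply: below => //; right; right.
- move=> below x /mapP [y hy ->]; apply: disjunct_dia.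
  by apply: IHa hy => B p q hB hs; apply: below => //; right.
Qed.

(** * Elimination of the pure variables *)

Section PureSubstitution.

Variable sigma : nat -> form.
Hypothesis sigma_pure : forall q, [\/ sigma q = Top, sigma q = Bot | sigma q = Var q].

Lemma pure_pol s q p : p != q -> pol_in s q (sigma p).
Proof. by move=> pq; case: (sigma_pure p) => -> //=; rewrite (negPf pq). Qed.

Lemma pol_in_pure_subst s q a : pol_in s q a -> pol_in s q (subst sigma a).
Proof.
move=> pol_a; apply: pol_in_subst => t r.
have [->|/pure_pol ->] := eqVneq r q; last by rewrite orbT.
case: (sigma_pure q) => -> /=; rewrite ?orbT // eqxx /=.
by move: pol_a; case: s t => [] [] /=; rewrite ?orbT // => ->.
Qed.

(** The head is the only occurrence that is not negative: keeping it keeps the shape, and making it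
    a constant leaves a negative formula. *)
Lemma boxlike_pure_subst p d :
  boxlike p d -> boxlike p (subst sigma d) \/ negative_form (subst sigma d).
Proof.
elim=> [|d' _ [IH|IH]|n d' neg_n below_n _ IH] /=.
- by case: (sigma_pure p) => ->; [right|right|left; apply: boxlike_var].
- by left; apply: boxlike_box.
- by right.
- have neg_n' : negative_form (subst sigma n) by move=> q; apply: pol_in_pure_subst.
  case: IH => [IH|IH]; last by right=> q /=; rewrite neg_n' IH.
  left; apply: boxlike_or => // q hq; apply: below_n.
  by apply: contra hq; apply: pol_in_pure_subst.
Qed.

Lemma disjunct_pure_subst a :
  inductive_disjunct a -> inductive_disjunct (subst sigma a).
Proof.
elim=> {a} [a neg_a|p d /boxlike_pure_subst [bd|neg_d]|a b _ IHa _ IHb|a _ IHa] /=.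
- by apply: disjunct_neg => q; apply: pol_in_pure_subst.
- exact: disjunct_box bd.
- exact: disjunct_neg.
- exact: disjunct_and.
- exact: disjunct_dia.
Qed.

End PureSubstitution.

(** A variable of both polarities is absent, so this says that every variable left in [S] has a
    positive occurrence. *)
Definition no_negative_only S :=
  forall p, all (negative_in p) S -> all (positive_in p) S.

(** A variable sent to a constant is gone. One that is kept has its occurrences untouched, so being
    negative now it was negative in [S] and would not have been kept. *)
Lemma eliminate_pure_no_negative_only S : no_negative_only (eliminate_pure S).
Proof.
rewrite /eliminate_pure; set sigma := (X in subst X).
have pure q : [\/ sigma q = Top, sigma q = Bot | sigma q = Var q].
  rewrite /sigma; case: ifP => _; first exact: Or31.
  by case: ifP => _; [apply: Or32|apply: Or33].
move=> p neg_S; apply/allP => _ /mapP [e e_S ->].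
have pure_e : pol_in true p (sigma p) -> pol_in false p (sigma p) ->
    positive_in p (subst sigma e).
  move=> pos_p neg_p; apply: pol_in_subst => t r.
  have [->|/(pure_pol pure) ->] := eqVneq r p; last by rewrite orbT.
  by case: t; rewrite ?pos_p ?neg_p orbT.
case: (pure p) => sp; try by apply: pure_e; rewrite sp.
have neg_p : all (negative_in p) S.
  apply/allP => e' e'_S; apply: pol_in_subst_fixed sp _.
  by move/allP: neg_S; apply; apply: map_f.
by move: sp; rewrite /sigma neg_p; case: ifP.
Qed.

(** * Decomposition of the initial equation *)

Definition sqema_steps := clos_refl_trans system sqema_step.

Definition same_polarities (S S' : system) :=
  forall s p, all (pol_in s p) S = all (pol_in s p) S'.

(** Quantifying over the ambient system allows equations to be decomposed one after another,
    although freshness of nominals depends on the whole system. *)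
Definition resolvable e := forall S, e \in S ->
  exists S', [/\ sqema_steps S S', same_polarities S S' &
    forall x, x \in S' -> shaped x \/ x \in S /\ x != e].

Lemma shaped_resolvable e : shaped e -> resolvable e.
Proof.
move=> shaped_e S e_S; exists S; split=> //; first exact: rt_refl.
by move=> x x_S; have [->|] := eqVneq x e; [left|right].
Qed.

Lemma resolvable_seq (es S : system) : {in es, forall e, resolvable e} ->
  exists S', [/\ sqema_steps S S', same_polarities S S' &
    forall x, x \in S' -> shaped x \/ x \in S /\ x \notin es].
Proof.
elim: es S => [|e es IHes] S res; first by exists S; split=> //; [apply: rt_refl|right].
have [S1 [steps1 pol1 S1_S]] : exists S1, [/\ sqema_steps S S1, same_polarities S S1 &
    forall x, x \in S1 -> shaped x \/ x \in S /\ x != e].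
  (* An entry absent from the current system, as may happen with repetitions, needs no step. *)
  have [e_S|e_S] := boolP (e \in S); first exact: (res e (mem_head _ _) S e_S).
  exists S; split=> //; first exact: rt_refl.
  by move=> x x_S; right; split=> //; apply: contraNneq e_S => <-.
have [|S2 [steps2 pol2 S2_S1]] := IHes S1.
  by move=> x x_es; apply: res; rewrite inE x_es orbT.
exists S2; split; first exact: rt_trans steps1 steps2.
  by move=> s p; rewrite pol1 pol2.
move=> x /S2_S1 [|[/S1_S [|[x_S xe]] x_es]]; [by left|by left|right].
by rewrite inE negb_or xe.
Qed.

Lemma resolvable_rule e :
  (forall N, exists es, [/\ eq_rule N e es, same_polarities [:: e] es &
    {in es, forall x, resolvable x}]) ->
  resolvable e.
Proof.
move=> rule_e S e_S; have [es [rule_es pol_es res]] := rule_e (flatten (map noms S)).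
set S1 := es ++ [seq x <- S | x != e].
have step1 : sqema_step S S1.
  apply: step_rule rule_es _; first exact/InP.
  move=> x; split.
    move/InP; rewrite mem_cat mem_filter => /orP [/InP|/andP [/eqP xe /InP]].
      by right.
    by left.
  case=> [[/InP x_S /eqP xe]|/InP x_es]; apply/InP; rewrite mem_cat ?x_es //.
  by rewrite mem_filter xe x_S orbT.
have pol1 : same_polarities S S1.
  move=> s p; rewrite all_cat -pol_es /= andbT.
  apply/idP/idP => [/allP pol_S|/andP [pol_e /allP pol_S]].
    rewrite pol_S //=; apply/allP => x; rewrite mem_filter => /andP [_].
    exact: pol_S.
  apply/allP => x x_S; have [->//|xe] := eqVneq x e.
  by apply: pol_S; rewrite mem_filter xe.
have [S2 [steps2 pol2 S2_S1]] := resolvable_seq S1 res.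
exists S2; split; first by apply: rt_trans steps2; apply: rt_step.
  by move=> s p; rewrite pol1 pol2.
move=> x /S2_S1 [|[]]; first by left.
rewrite mem_cat mem_filter => /orP [->//|/andP [xe x_S] _].
by right.
Qed.

Lemma resolvable_rule1 e e' :
  (forall N, eq_rule N e [:: e']) -> same_polarities [:: e] [:: e'] ->
  resolvable e' -> resolvable e.
Proof.
move=> rule_e pol_e res; apply: resolvable_rule => N; exists [:: e']; split=> //.
by move=> x; rewrite inE => /eqP ->.
Qed.

(** The left-shift rules strip [d] down to its head. Each [n] moves to the antecedent as [Neg n],
    which is positive with its variables below [p]. *)
Lemma resolvable_boxlike p d g :
  boxlike p d -> positive_below p g -> resolvable (Imp g d).
Proof.
move=> bd; elim: bd g => [|d' _ IHd|n d' neg_n below_n _ IHd] g [pos_g below_g].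
- by apply: shaped_resolvable; apply: shaped_pos.
- apply: (resolvable_rule1 (e' := Imp (DiaInv g) d')) => [N||]; first exact: rule_box_left.
    by [].
  exact: IHd.
- apply: (resolvable_rule1 (e' := Imp (And g (Neg n)) d')) => [N||].
  + exact: rule_or_left.
  + by move=> s q /=; rewrite negbK !andbA.
  apply: IHd; split=> q /=; first by rewrite pos_g neg_n.
  by rewrite negb_and => /orP [/below_g|/below_n].
Qed.

(** [rule_dia] needs a nominal as antecedent; a general [j] lets the induction pass to the new
    nominals. *)
Lemma resolvable_disjunct a :
  inductive_disjunct a -> forall j, resolvable (Imp (Nom j) a).
Proof.
elim=> {a} [a neg_a|p d bd|a b _ IHa _ IHb|a _ IHa] j.
- by apply: shaped_resolvable; apply: shaped_neg => p /=.
- exact: (resolvable_boxlike bd).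
- apply: resolvable_rule => N; exists [:: Imp (Nom j) a; Imp (Nom j) b].
  split; [exact: rule_and|by move=> s p /=; rewrite !andbT|].
  by move=> x; rewrite !inE => /orP [] /eqP ->.
(* The successor of the maximum is outside [N] and differs from [nom_i], which is 0. *)
- apply: resolvable_rule => N; set k := (\max_(i <- N) i).+1.
  exists [:: Imp (Nom j) (Dia (Nom k)); Imp (Nom k) a]; split=> //.
    apply: rule_dia => //; apply/negP => k_N.
    by have := @leq_bigmax_seq _ N xpredT id k k_N isT; rewrite ltnn.
  move=> x; rewrite !inE => /orP [] /eqP -> //.
  by apply: shaped_resolvable; apply: shaped_neg.
Qed.

(** * Elimination of the heads *)

Lemma solved_forP p e a : solved_for p e = Some a -> e = Imp a (Var p).
Proof. by case: e => //= b [] //= q; case: andP => // -[/eqP -> _] [->]. Qed.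

(** An occurrence of [p] in [g] would put [p] below itself. *)
Lemma solved_shaped p g : positive_below p g -> solved_for p (Imp g (Var p)) = Some g.
Proof.
move=> [pos_g below_g] /=; rewrite eqxx pol_in_vars pos_g /=.
by case: (boolP (pol_in false p g)) => // /below_g /R_irrefl.
Qed.

Lemma shaped_head p g : shaped (Imp g (Var p)) -> positive_below p g.
Proof.
move def_e: (Imp g (Var p)) => e shaped_e.
case: shaped_e def_e => [e' neg_e' def_e|h q hq [-> ->] //].
by move: (neg_e' p); rewrite -def_e /= eqxx andbF.
Qed.

(** [F] is positive and free of [p], and [p] is negative in the unsolved members, so negative
    members stay negative and antecedents stay positive. Variables that [F] brings into an
    antecedent of head [q] are below [p], which is below [q]. The last conclusion serves as
    termination measure. *)
Lemma ackermann_shaped p S (F := bigor (solutions p S))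
    (S' := map (subst1 p F) (unsolved p S)) :
  {in S, forall e, shaped e} -> no_negative_only S -> ~~ all (negative_in p) S ->
  [/\ sqema_step S S', {in S', forall e, shaped e}, no_negative_only S' &
      forall q, ~~ all (negative_in q) S' -> q != p /\ ~~ all (negative_in q) S].
Proof.
move=> shaped_S nno_S p_S; set sigma := fun q => if q == p then F else Var q.
have solutionP g : g \in solutions p S -> Imp g (Var p) \in S.
  by rewrite mem_pmap => /mapP [e e_S /esym /solved_forP <-].
have unsolvedP e : e \in unsolved p S -> e \in S /\ forall g, e <> Imp g (Var p).
  rewrite mem_filter => /andP [unsolved_e e_S]; split=> // g def_e.
  move: unsolved_e; rewrite def_e solved_shaped //.
  by apply: shaped_head; rewrite -def_e; apply: shaped_S.
have pos_F q : pol_in true q F.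
  rewrite pol_in_bigor; apply/allP => g /solutionP /shaped_S /shaped_head [pos_g _].
  exact: pos_g.
have below_F q : ~~ pol_in false q F -> R q p.
  rewrite pol_in_bigor => /allPn [g /solutionP /shaped_S /shaped_head [_ below_g]].
  exact: below_g.
have F_p : pol_in false p F by case: (boolP (pol_in _ _ _)) => // /below_F /R_irrefl.
have sigma_pos q r : pol_in true q (sigma r).
  by rewrite /sigma; case: ifP => //= _; rewrite implybT.
have neg_subst q e : pol_in false q e -> negative_in p e -> pol_in false q (subst sigma e).
  move=> neg_q neg_p; apply: pol_in_subst => -[] r /=; last by rewrite sigma_pos orbT.
  rewrite /sigma; have [->|rp] := eqVneq r p; first by apply/orP; left.
  have [->|rq] := eqVneq r q; first by rewrite neg_q.
  by rewrite /= (negPf rq) orbT.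
have neg_unsolved e : e \in unsolved p S -> negative_in p e.
  move=> /unsolvedP [/shaped_S]; case=> [e' neg_e' _|g q [pos_g _] q_p].
    exact: neg_e'.
  rewrite /negative_in /= pos_g /=; case: (eqVneq q p) => // qp.
  by case: (q_p g); rewrite qp.
have fresh_p s e : pol_in s p (subst sigma e).
  apply: pol_in_subst => t r; rewrite /sigma; have [rp|rp] := eqVneq r p.
    by case: (t == s); rewrite ?pos_F ?F_p orbT.
  by rewrite /= (negPf rp) orbT.
split.
- apply: step_ackermann; last exact/allP.
  (* A member with a positive occurrence of [p] must be an equation with consequent [p], so there is
     a solution. *)
  case/allPn: p_S => e e_S; case: (shaped_S _ e_S) (e_S) => [e' neg_e' _|g q gq gq_S].
    by rewrite /negative_in neg_e'.
  rewrite /negative_in /= (proj1 gq) /=; case: (eqVneq q p) => // qp _; subst q.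
  have : g \in solutions p S by rewrite mem_pmap -(solved_shaped gq) map_f.
  by case: (solutions p S).
- move=> _ /mapP [e e_u ->]; have neg_p := neg_unsolved e e_u.
  case/unsolvedP: e_u => /shaped_S shaped_e.
  case: shaped_e neg_p => [e' neg_e' neg_p _|g q [pos_g below_g] neg_p q_p].
    by apply: shaped_neg => q; apply: neg_subst.
  have qp : q != p by apply/eqP => qp; apply: (q_p g); rewrite qp.
  rewrite /subst1 /= (negPf qp); apply: shaped_pos; split=> r.
    apply: pol_in_subst => -[] x /=; first by rewrite sigma_pos orbT.
    by rewrite pos_g.
  (* Either [r] occurs in [g], or it comes from [F] while [p] occurs in [g]; in all other cases [r]
     is absent. *)
  move=> r_g; have [g_r|/below_g //] := boolP (pol_in false r g).
  have [F_r|/below_F r_p] := boolP (pol_in false r F); last first.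
    have [g_p|/below_g] := boolP (pol_in false p g); last exact: R_trans.
    case/negP: r_g; apply: pol_in_subst => -[] x /=; last by rewrite pos_g.
    have [->|xp] := eqVneq x p; first by rewrite g_p.
    have [->|xr] := eqVneq x r; first by rewrite g_r.
    by rewrite /= (negPf xr) orbT.
  case/negP: r_g; apply: pol_in_subst => -[] x /=; last by rewrite pos_g.
  have [->|xp] := eqVneq x p; first by rewrite F_r orbT.
  have [->|xr] := eqVneq x r; first by rewrite g_r.
  by rewrite /= (negPf xr) orbT.
- move=> q neg_S'; apply/allP => _ /mapP [e e_u ->].
  have [->|qp] := eqVneq q p; first exact: fresh_p.
  have sq : sigma q = Var q by rewrite /sigma (negPf qp).
  (* The solved equations are negative in [q] too: their antecedents are positive and their
     consequent is [p]. So the invariant of [S] applies to [q]. *)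
  have /allP pos_S : all (positive_in q) S.
    apply: nno_S; apply/allP => e' e'_S; case: (boolP (e' \in unsolved p S)) => e'_u.
      by apply: (pol_in_subst_fixed sq); move/allP: neg_S'; apply; apply: map_f.
    move: e'_u; rewrite mem_filter e'_S andbT negbK.
    case solved_e' : (solved_for p e') => [g|] // _.
    move/solved_forP: solved_e' => def_e'; rewrite def_e' in e'_S *.
    rewrite /negative_in /= (proj1 (shaped_head (shaped_S _ e'_S))) /=.
    by rewrite eq_sym (negPf qp).
  have F_q : pol_in false q F.
    rewrite pol_in_bigor; apply/allP => g /solutionP /pos_S.
    by rewrite /positive_in /= => /andP [].
  have e_q : pol_in true q e by apply: pos_S; case/unsolvedP: e_u.
  apply: pol_in_subst => t r; rewrite /sigma.
  have [_|rp] := eqVneq r p; first by case: t => /=; rewrite ?pos_F ?F_q orbT.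
  have [->|rq] := eqVneq r q; last by rewrite /= (negPf rq) orbT.
  by case: t => /=; rewrite ?eqxx ?orbT // e_q.
- move=> q neg_q; have qp : q != p.
    apply: contra neg_q => /eqP ->; apply/allP => _ /mapP [e _ ->]; exact: fresh_p.
  split=> //; apply: contra neg_q => /allP neg_S; apply/allP => _ /mapP [e e_u ->].
  apply: neg_subst; last exact: neg_unsolved.
  by apply: neg_S; case/unsolvedP: e_u.
Qed.

(** The list [l] bounds the variables with a positive occurrence, and each Ackermann step removes
    one. Once none is left, [no_negative_only] excludes all other variables. *)
Lemma eliminate_heads (l : seq nat) S :
  {in S, forall e, shaped e} -> no_negative_only S ->
  (forall p, ~~ all (negative_in p) S -> p \in l) ->
  exists S', sqema_steps S S' /\ all (fun e => nilp (vars e)) S'.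
Proof.
elim: l S => [|p l IHl] S shaped_S nno_S heads.
  have neg_S p : all (negative_in p) S by case: (boolP (all _ _)) => // /heads.
  exists S; split; first exact: rt_refl.
  apply/allP => e e_S; case def_e : (vars e) => [|p vs] //.
  have : p \in vars e by rewrite def_e mem_head.
  have pos_e : pol_in true p e := allP (nno_S p (neg_S p)) _ e_S.
  have neg_e : pol_in false p e := allP (neg_S p) _ e_S.
  by rewrite pol_in_vars pos_e neg_e.
have [neg_p|p_S] := boolP (all (negative_in p) S).
  apply: IHl => // q q_S; move: (heads q q_S); rewrite inE => /predU1P [qp|//].
  by rewrite qp neg_p in q_S.
have [step1 shaped_S' nno_S' heads'] := ackermann_shaped shaped_S nno_S p_S.
have [|S'' [steps'' vars_S'']] := IHl _ shaped_S' nno_S'.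
  by move=> q /heads' [qp /heads]; rewrite inE (negPf qp).
exists S''; split=> //; apply: rt_trans steps''; exact: rt_step.
Qed.

Lemma sqema_disjunct a : inductive_disjunct a ->
  exists S, sqema_steps (eliminate_pure (initial_system a)) S
            /\ all (fun e => nilp (vars e)) S.
Proof.
move=> disj_a; have := @eliminate_pure_no_negative_only (initial_system a).
rewrite /eliminate_pure; set sigma := (X in subst X) => /= nno.
have disj_b : inductive_disjunct (subst sigma a).
  apply: disjunct_pure_subst disj_a => q; rewrite /sigma.
  case: ifP => _; first exact: Or31.
  by case: ifP => _; [apply: Or32|apply: Or33].
have e0_S0 : Imp (Nom nom_i) (subst sigma a) \in [:: Imp (Nom nom_i) (subst sigma a)].
  exact: mem_head.
have [S1 [steps1 pol1 shaped_S1]] := resolvable_disjunct disj_b e0_S0.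
have [|||S [steps vars_S]] := @eliminate_heads (flatten (map vars S1)) S1.
- by move=> x /shaped_S1 [//|[]]; rewrite inE => ->.
- by move=> p; rewrite /negative_in /positive_in -!pol1; apply: nno.
- move=> p /allPn [e e_S1 e_p]; apply/flattenP; exists (vars e); first exact: map_f.
  by rewrite pol_in_vars negb_and e_p orbT.
by exists S; split=> //; apply: rt_trans steps.
Qed.

End Dependency.

(** * Subformulae and the dependency digraph *)

Lemma subformula_trans a b c : subformula a b -> subformula b c -> subformula a c.
Proof.
by elim: c => /=; move=> *; intuition (subst; eauto).
Qed.

(** Serves to make [q] a vertex, since [dep_edge] asks this of both ends. *)
Lemma subformula_inessential B p q :
  q \in inessential B -> subformula (Var q) (fill B p).
Proof.
have var_sub a : q \in vars a -> subformula (Var q) a.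
  elim: a => //=; try by move=> *; right; auto.
  - by move=> p'; rewrite inE => /eqP ->; left.
  - by move=> a IHa b IHb; rewrite mem_cat => /orP [/IHa|/IHb]; right; [left|right].
  - by move=> a IHa b IHb; rewrite mem_cat => /orP [/IHa|/IHb]; right; [left|right].
  - by move=> a IHa b IHb; rewrite mem_cat => /orP [/IHa|/IHb]; right; [left|right].
elim: B => //= [B IHB /IHB|a B IHB]; first by right.
by rewrite mem_cat => /orP [/var_sub|/IHB]; right; [left|right].
Qed.

Theorem theorem5p12 (phi : form) (hphi : conjunction_of monadic_inductive phi) :
  sqema_succeeds phi.
Proof.
elim: hphi => {phi} [a [reg_a acyclic_a]|a b _ IHa _ IHb] x; last first.
  (* A negated conjunction is a disjunction, so its disjuncts are those of the negated conjuncts,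
     each treated with its own digraph. *)
  by move/InP; rewrite /= mem_cat => /orP [] /InP; [apply: IHa|apply: IHb].
(* For the transitive closure of the edges, irreflexivity is acyclicity. *)
move/InP => x_a; apply: (@sqema_disjunct (clos_trans nat (dep_edge (box_subformulae a)))).
- by move=> p q r; apply: t_trans.
- exact: acyclic_a.
apply: (disjuncts_regular reg_a _ x_a) => B p q box_B sub_B q_B.
apply: t_step; split; last by exists B; split=> //; split=> //; exists B, p.
  (* A variable is itself a box-formula, so [q] is a vertex of the digraph. *)
  exists Sharp; split=> //; split; first by exists Sharp, q.
  exact: subformula_trans (subformula_inessential p q_B) sub_B.
by exists B; split=> //; split=> //; exists B, p.
Qed.
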